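(* Let $r\geq 2$ be an integer. There is a bound $N_r$ (which one can take to be $N_r=r^4$) such that the following holds: (1) If $r$ is odd, there is a hyperfield $\mathbb{H}_r$, unique up to isomorphism, such that $\mathbb{F}_q/G^r_q$ is isomorphic to $\mathbb{H}_r$ (as hyperfields) for every prime power $q\geq N_r$ with $q\equiv 1\pmod r$. (2) If $r$ is even, there are two distinct (i.e. non-isomorphic) hyperfields $\mathbb{H}_r$ and $\mathbb{H}'_r$ such that for every prime power $q\geq N_r$ with $q\equiv 1\pmod{2r}$, $\mathbb{F}_q/G^r_q$ is isomorphic to $\mathbb{H}_r$, and for every prime power $q\geq N_r$ with $q\equiv r+1\pmod{2r}$, $\mathbb{F}_q/G^r_q$ is isomorphic to $\mathbb{H}'_r$.
   Context: A hyperoperation on a set $F$ is a function $\boxplus: F\times F\to \mathcal{P}(F)$ to the power set of $F$ such that $a\boxplus b\neq\emptyset$ for all $a,b\in F$. It is commutative if $a\boxplus b=b\boxplus a$ for all $a,b\in F$, and associative if $\bigcup_{d\in b\boxplus c} a\boxplus d=\bigcup_{d\in a\boxplus b} d\boxplus c$ for all $a,b,c\in F$. A hypergroup is a set $G$ with an associative hyperoperation $\boxplus$ such that: (i) there is an element $0\in G$ with $0\boxplus a=a\boxplus 0=\{a\}$ for all $a\in G$; (ii) for every $a \in G$ there is a unique element $-a\in G$ with $0\in a\boxplus(-a)$; (iii) for all $a,b,c \in G$, $a\in b\boxplus c$ if and only if $-b\in(-a)\boxplus c$. It is commutative if $\boxplus$ is commutative. A hyperfield is a set $\mathbb{H}$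 with a binary operation $\cdot$, a hyperoperation $\boxplus$, and distinct elements $0,1\in\mathbb{H}$ such that: $(\mathbb{H},\boxplus,0)$ is a commutative hypergroup; $(\mathbb{H}^\times,\cdot,1)$ is an abelian group, where $\mathbb{H}^\times=\mathbb{H}\setminus\{0\}$; $a\cdot 0=0\cdot a=0$ for all $a\in\mathbb{H}$; and $a\cdot(b\boxplus c)=ab\boxplus ac$ for all $a,b,c\in\mathbb{H}$, where $a\cdot(b\boxplus c)=\{ad : d\in b\boxplus c\}$. A hyperfield homomorphism $\phi:\mathbb{H}_1\to\mathbb{H}_2$ is a map with $\phi(0)=0$, $\phi(1)=1$, $\phi(ab)=\phi(a)\phi(b)$ and $\phi(a\boxplus_1 b)\subseteq\phi(a)\boxplus_2\phi(b)$ for all $a,b\in\mathbb{H}_1$. An isomorphism of hyperfields is a homomorphism that has an inverse homomorphism. For a field $F$ and a subgroup $G$ of $F^\times$, the quotient hyperfield $F/G$ is the multiplicative monoid $(F^\times/G)\cup\{0\}$ with hyperaddition $[a]\boxplus[b]=\{[c] : c=a'+b' \text{ for some } a'\in[a],\ b'\in[b]\}$, where $[a]=aG$ denotes the class of $a$ (and $[0]=\{0\}$). For a prime power $q$ and a positive integer $r$ dividing $q-1$, $\mathbb{F}_q$ is the finite field with $q$ elements and $G^r_q$ denotes the unique subgroup of $\mathbb{F}_q^\times$ of index $r$. *)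

(* Defs.v *)
From mathcomp Require Import all_boot all_algebra all_fingroup.
From mathcomp Require Import all_solvable finfield.
From mathcomp Require Import boolp classical_sets.

Import GRing.Theory.

Set Implicit Arguments.
Unset Strict Implicit.
Unset Printing Implicit Defensive.

Local Open Scope classical_set_scope.

Definition hyperop (T : Type) := T -> T -> set T.

(* [hg_oppP] and [hg_opp_uniq] together say that [opp a] is the unique element
   b with 0 \in a [+] b. *)
Record is_hypergroup (T : Type) (add : hyperop T) (zero : T) (opp : T -> T)
    : Prop := IsHypergroup {
  hg_nonempty : forall a b, add a b !=set0;
  hg_assoc : forall a b c,
    \bigcup_(d in add b c) add a d = \bigcup_(d in add a b) add d c;
  hg_add0l : forall a, add zero a = [set a];
  hg_add0r : forall a, add a zero = [set a];
  hg_oppP : forall a, add a (opp a) zero;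
  hg_opp_uniq : forall a b, add a b zero -> b = opp a;
  hg_reversible : forall a b c, add b c a <-> add (opp a) c (opp b)
}.

Record hyperfield : Type := Hyperfield {
  hf_sort :> Type;
  hf_add : hyperop hf_sort;
  hf_mul : hf_sort -> hf_sort -> hf_sort;
  hf_zero : hf_sort;
  hf_one : hf_sort;
  hf_opp : hf_sort -> hf_sort;
  hf_one_neq0 : hf_one <> hf_zero;
  hf_hypergroup : is_hypergroup hf_add hf_zero hf_opp;
  hf_addC : forall a b, hf_add a b = hf_add b a;
  hf_mul_neq0 : forall a b,
    a <> hf_zero -> b <> hf_zero -> hf_mul a b <> hf_zero;
  hf_mulA : forall a b c, a <> hf_zero -> b <> hf_zero -> c <> hf_zero ->
    hf_mul a (hf_mul b c) = hf_mul (hf_mul a b) c;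
  hf_mulC : forall a b, a <> hf_zero -> b <> hf_zero ->
    hf_mul a b = hf_mul b a;
  hf_mul1 : forall a, a <> hf_zero -> hf_mul hf_one a = a;
  hf_mulV : forall a, a <> hf_zero ->
    exists2 b, b <> hf_zero & hf_mul a b = hf_one;
  hf_mul0l : forall a, hf_mul hf_zero a = hf_zero;
  hf_mul0r : forall a, hf_mul a hf_zero = hf_zero;
  hf_mulD : forall a b c,
    hf_mul a @` hf_add b c = hf_add (hf_mul a b) (hf_mul a c)
}.

Record is_hyperfield_hom (H1 H2 : hyperfield) (phi : H1 -> H2) : Prop :=
  IsHyperfieldHom {
  hom_zero : phi (hf_zero H1) = hf_zero H2;
  hom_one : phi (hf_one H1) = hf_one H2;
  hom_mul : forall a b, phi (hf_mul a b) = hf_mul (phi a) (phi b);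
  hom_add : forall a b, phi @` hf_add a b `<=` hf_add (phi a) (phi b)
}.

Definition hyperfield_iso (H1 H2 : hyperfield) : Prop :=
  exists (phi : H1 -> H2) (psi : H2 -> H1),
    [/\ is_hyperfield_hom phi, is_hyperfield_hom psi,
        cancel phi psi & cancel psi phi].

Section QuotientHyperfield.

Variables (F : finFieldType) (G : {group {unit F}}).

Local Open Scope ring_scope.

(* (F^x / G) together with 0, which is represented by None *)
Definition quot_type : Type := option (coset_of G).

Definition quot_class (a : F) : quot_type :=
  omap (coset G) (insub a : option {unit F}).

Definition quot_add : hyperop quot_type := fun A B =>
  [set C | exists a b : F,
     [/\ quot_class a = A, quot_class b = B & C = quot_class (a + b)]].

Definition quot_mul (A B : quot_type) : quot_type :=
  if A is Some u then if B is Some v then Some (u * v)%g else None else None.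

Definition quot_zero : quot_type := None.
Definition quot_one : quot_type := Some 1%g.
Definition quot_opp (A : quot_type) : quot_type :=
  quot_mul (quot_class (-1)) A.

Lemma unit_abelian : abelian [set: {unit F}]%SET.
Proof. exact: cyclic_abelian (field_unit_group_cyclic _). Qed.

Lemma in_norm_unit (u : {unit F}) : u \in 'N(G)%g.
Proof.
have := sub_abelian_norm unit_abelian (finset.subsetT G).
by move/fintype.subsetP; apply; rewrite finset.in_setT.
Qed.

Lemma quot_class0 : quot_class 0 = quot_zero.
Proof. by rewrite /quot_class insubF // unitr0. Qed.

Lemma quot_classU (u : {unit F}) : quot_class (val u) = Some (coset G u).
Proof. by rewrite /quot_class valK. Qed.

Lemma quot_class1 : quot_class 1 = quot_one.
Proof. by rewrite -[1]/(val (1%g : {unit F})) quot_classU coset_id. Qed.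

Variant unit_spec : F -> Type :=
| UnitSpec0 : unit_spec 0
| UnitSpecU (u : {unit F}) : unit_spec (val u).

Lemma unitP (a : F) : unit_spec a.
Proof.
have [->|a0] := eqVneq a 0; first by constructor.
have Ua : a \is a GRing.unit by rewrite unitfE.
by rewrite -[a]/(val (FinRing.unit F Ua)); constructor.
Qed.

Lemma quot_classM a b : quot_class (a * b) = quot_mul (quot_class a) (quot_class b).
Proof.
case: (unitP a) => [|u]; first by rewrite mul0r quot_class0.
case: (unitP b) => [|v].
  by rewrite mulr0 quot_class0; case: (quot_class _).
by rewrite -FinRing.val_unitM !quot_classU morphM ?in_norm_unit.
Qed.

Lemma quot_class_onto (A : quot_type) : exists a, quot_class a = A.
Proof.
case: A => [c|]; last by exists 0; exact: quot_class0.
by case: (cosetP c) => u _ ->; exists (val u); rewrite quot_classU.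
Qed.

Lemma quot_class_eq a b : quot_class a = quot_class b ->
  exists2 g, quot_class g = quot_one & b = a * g.
Proof.
case: (unitP a) => [|u]; case: (unitP b) => [|v];
  rewrite ?quot_class0 ?quot_classU //.
  by move=> _; exists 1; rewrite ?quot_class1 ?mulr1.
move=> /Some_inj uv; exists (val (u^-1 * v)%g); last first.
  by rewrite -FinRing.val_unitM mulKVg.
by rewrite quot_classU morphM ?in_norm_unit // morphV ?in_norm_unit //= uv mulVg.
Qed.

Lemma quot_mulC A B : quot_mul A B = quot_mul B A.
Proof.
have [a <-] := quot_class_onto A; have [b <-] := quot_class_onto B.
by rewrite -!quot_classM mulrC.
Qed.

Lemma quot_mulA A B C : quot_mul A (quot_mul B C) = quot_mul (quot_mul A B) C.
Proof. by case: A B C => [a|] [b|] [c|] //=; rewrite mulgA. Qed.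

Lemma quot_mul1 A : quot_mul quot_one A = A.
Proof. by case: A => [a|] //=; rewrite mul1g. Qed.

Lemma quot_mulr1 A : quot_mul A quot_one = A.
Proof. by rewrite quot_mulC quot_mul1. Qed.

Lemma quot_class_opp a : quot_class (- a) = quot_opp (quot_class a).
Proof. by rewrite /quot_opp -quot_classM mulN1r. Qed.

Lemma quot_class_eq0 a : quot_class a = quot_zero -> a = 0.
Proof. by case: (unitP a) => // u; rewrite quot_classU. Qed.

Lemma quot_addP a B C : quot_add (quot_class a) B C <->
  exists2 b, quot_class b = B & C = quot_class (a + b).
Proof.
split=> [[a' [b [aa' bB ->]]]|[b bB ->]]; last by exists a, b.
have [g g1 ->] := quot_class_eq aa'.
exists (b * g); first by rewrite quot_classM g1 quot_mulr1.
by rewrite -mulrDl quot_classM g1 quot_mulr1.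
Qed.

Lemma quot_addC A B : quot_add A B = quot_add B A.
Proof.
by apply/seteqP; split=> C [a [b [aA bB ->]]]; exists b, a; rewrite addrC.
Qed.

Lemma quot_addA A B C : \bigcup_(D in quot_add B C) quot_add A D =
                        \bigcup_(D in quot_add A B) quot_add D C.
Proof.
have sub X Y Z : \bigcup_(D in quot_add Y Z) quot_add X D `<=`
                 \bigcup_(D in quot_add X Y) quot_add D Z.
  move=> E [_ [y [z [yY zZ ->]]]]; rewrite quot_addC => /quot_addP[x xX ->].
  exists (quot_class (x + y)); first by exists x, y.
  by exists (x + y), z; split=> //; rewrite [_ + x]addrC addrA.
apply/seteqP; split; first exact: sub.
rewrite (quot_addC A B) => E [D hD]; rewrite quot_addC => hE.
have [|D' hD' hE'] := sub C B A E; first by exists D.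
by exists D'; [rewrite quot_addC | rewrite quot_addC].
Qed.

Lemma quot_add0 A : quot_add quot_zero A = [set A].
Proof.
apply/seteqP; split=> C /=.
  by rewrite -quot_class0 => /quot_addP[b <- ->]; rewrite add0r.
have [a <-] := quot_class_onto A => ->.
by exists 0, a; rewrite add0r quot_class0.
Qed.

Lemma quot_rev A B C : quot_add B C A -> quot_add (quot_opp A) C (quot_opp B).
Proof.
move=> [b [c [<- <- ->]]]; exists (- (b + c)), c.
by rewrite quot_class_opp opprD subrK quot_class_opp.
Qed.

Lemma quot_oppK A : quot_opp (quot_opp A) = A.
Proof.
by have [a <-] := quot_class_onto A; rewrite -!quot_class_opp opprK.
Qed.

Lemma quot_hypergroup : is_hypergroup quot_add quot_zero quot_opp.
Proof.
split.
- move=> A B; have [a <-] := quot_class_onto A.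
  by have [b <-] := quot_class_onto B; exists (quot_class (a + b)), a, b.
- exact: quot_addA.
- exact: quot_add0.
- by move=> A; rewrite quot_addC quot_add0.
- move=> A; have [a <-] := quot_class_onto A; exists a, (- a).
  by rewrite quot_class_opp subrr quot_class0.
- move=> A B [a [b [<- <- /esym/quot_class_eq0]]].
  by move/eqP; rewrite addrC addr_eq0 => /eqP ->; exact: quot_class_opp.
- move=> A B C; split=> [|/quot_rev]; first exact: quot_rev.
  by rewrite !quot_oppK.
Qed.

Lemma quot_mulD A B C :
  quot_mul A @` quot_add B C = quot_add (quot_mul A B) (quot_mul A C).
Proof.
have [a <-] := quot_class_onto A; apply/seteqP; split=> D.
  move=> [_ [b [c [<- <- ->]]] <-]; exists (a * b), (a * c).
  by rewrite -mulrDr !quot_classM.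
have [b <-] := quot_class_onto B; have [c <-] := quot_class_onto C.
rewrite -!quot_classM => /quot_addP[_ /esym/quot_class_eq[g g1 ->] ->].
exists (quot_class (b + c * g)).
  by exists b, (c * g); split=> //; rewrite quot_classM g1 quot_mulr1.
by rewrite -quot_classM mulrDr mulrA.
Qed.

Lemma quot_one_neq0 : quot_one <> quot_zero. Proof. by []. Qed.

Lemma quot_mul_neq0 A B :
  A <> quot_zero -> B <> quot_zero -> quot_mul A B <> quot_zero.
Proof. by case: A B => [a|] [b|]. Qed.

Lemma quot_mulV A : A <> quot_zero ->
  exists2 B, B <> quot_zero & quot_mul A B = quot_one.
Proof. by case: A => [a|] // _; exists (Some a^-1%g); rewrite //= mulgV. Qed.

Lemma quot_mulr0 A : quot_mul A quot_zero = quot_zero.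
Proof. by case: A. Qed.

Definition quotient_hyperfield : hyperfield := {|
  hf_sort := quot_type;
  hf_add := quot_add;
  hf_mul := quot_mul;
  hf_zero := quot_zero;
  hf_one := quot_one;
  hf_opp := quot_opp;
  hf_one_neq0 := quot_one_neq0;
  hf_hypergroup := quot_hypergroup;
  hf_addC := quot_addC;
  hf_mul_neq0 := quot_mul_neq0;
  hf_mulA := fun A B C _ _ _ => quot_mulA A B C;
  hf_mulC := fun A B _ _ => quot_mulC A B;
  hf_mul1 := fun A _ => quot_mul1 A;
  hf_mulV := quot_mulV;
  hf_mul0l := fun A => erefl quot_zero;
  hf_mul0r := quot_mulr0;
  hf_mulD := quot_mulD |}.

End QuotientHyperfield.

(* G is the subgroup G^r_q of F^x, for q = #|F|. *)
Definition is_index_subgroup (F : finFieldType) (r : nat)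
    (G : {group {unit F}}) : Prop :=
  #|[set: {unit F}]%SET : G|%g = r.

Lemma index_subgroup_exists_unique (F : finFieldType) (r : nat) :
  (r %| #|F|.-1)%N -> exists! G : {group {unit F}}, is_index_subgroup r G.
Proof.
move=> rF; have cU := field_unit_group_cyclic [set: {unit F}]%G.
have cardU : #|[set: {unit F}]%SET| = #|F|.-1 by rewrite card_finField_unit.
have U_gt0 : (0 < #|F|.-1)%N by rewrite -cardU cardG_gt0.
have [x Ux] := cyclicP cU.
have ox : #[x]%g = #|F|.-1 by rewrite -cardU Ux.
have dvd_r : (#|F|.-1 %/ r %| #[x]%g)%N by rewrite ox dvdn_div.
have r_gt0 : (0 < r)%N by exact: dvdn_gt0 rF.
exists <[x ^+ r]>%G; split.
  rewrite /is_index_subgroup -divgS ?finset.subsetT // cardU -orderE.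
  by rewrite orderXdiv ox // divnA // mulKn.
move=> G iG; apply/val_inj/eqP; rewrite /= (eq_subG_cyclic cU) ?finset.subsetT //.
rewrite -orderE orderXdiv ?ox //.
have := Lagrange (finset.subsetT G); rewrite iG cardU => <-.
by rewrite mulnK.
Qed.

(* Main.v *)
Require Import Defs.
From mathcomp Require Import boolp classical_sets.
From mathcomp Require Import all_boot all_order all_algebra all_fingroup.
From mathcomp Require Import all_solvable finfield.
From mathcomp Require Import ring zify.

(* Write q = #|F|, m = #|G|, so q - 1 = r m. For q >= r^4 the equation
   a x + b y = c z with a, b, c nonzero always has a solution in G, so the sum
   of two nonzero classes [a], [b] contains every nonzero class, and it
   contains 0 exactly when [b] = [-1][a]. The hyperfield is thus determined by
   the cyclic group F^x / G of order r and by the class of -1, which is trivial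
   when r is odd or q = 1 mod 2r, and is the element of order 2 when
   q = r + 1 mod 2r.

   Solvability does not require character sums: rescaling by G, a missing
   solution means that the m^2 lines Y = k X + l with k in aG, l in bG all
   avoid the m^2 points of G x cG. Over all q^2 such lines, the
   number of incidences with these points has mean m^2 / q and total squared
   deviation m^2 (q - m), because two points with distinct abscissae lie on
   exactly one line. Hence m^2 (m^2 / q)^2 <= m^2 (q - m), which fails for
   q >= r^4. *)

Import Order.TTheory GRing.Theory Num.Theory.

Set Implicit Arguments.
Unset Strict Implicit.
Unset Printing Implicit Defensive.

(** * Incidences of lines with a grid in the affine plane *)

Section Incidences.
Variables (F : finFieldType) (U V : {set F}).
Local Open Scope ring_scope.

(** The pair [p] = (k, l) is the line Y = k X + l, and [on p u] tells whether its point of abscissa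
    u lies in the grid U x V. *)
Let on (p : F * F) (u : F) : int := (p.1 * u + p.2 \in V)%:R.
Definition incidences (p : F * F) : int := \sum_(u in U) on p u.

Lemma sum_mem (T : finType) (A : {set T}) : \sum_x (x \in A)%:R = #|A|%:R :> int.
Proof. by rewrite -natr_sum -big_mkcond sum1_card. Qed.

Lemma sum_lines_at u : \sum_p on p u = (#|F| * #|V|)%:R.
Proof.
rewrite (reindex (fun p : F * F => (p.1, p.2 - p.1 * u))) /=; last first.
  by exists (fun p => (p.1, p.2 + p.1 * u)) => -[k l] _ /=; rewrite ?subrK ?addrK.
rewrite -(pair_bigA _ (fun k l => on (k, l - k * u) u)) /=.
under eq_bigr => k _ do under eq_bigr => l _ do rewrite /on /= addrC subrK.
by rewrite sum_mem sumr_const -[LHS]mulr_natl natrM.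
Qed.

(** A line is determined by its ordinates a, b at two distinct abscissae; [h] recovers it from
    them. *)
Lemma sum_lines_at2 u u' : u != u' -> \sum_p on p u * on p u' = (#|V| ^ 2)%:R.
Proof.
move=> uu'; have du : u - u' != 0 by rewrite subr_eq0.
pose h (p : F * F) := let k := (p.1 - p.2) / (u - u') in (k, p.1 - k * u).
rewrite (reindex h) /=; last first.
  exists (fun p => (p.1 * u + p.2, p.1 * u' + p.2)) => -[a b] _ /=;
    rewrite /h /=; congr (_, _); field => //.
have -> : \sum_p on (h p) u * on (h p) u' =
          \sum_p (p.1 \in V)%:R * (p.2 \in V)%:R.
  apply: eq_bigr => -[a b] _; rewrite /on /h /=.
  by congr ((_ \in V)%:R * (_ \in V)%:R); field.
rewrite -(pair_bigA _ (fun a b => (a \in V)%:R * (b \in V)%:R)) /=.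
under eq_bigr => a _ do rewrite -mulr_sumr sum_mem.
by rewrite -mulr_suml sum_mem natrX expr2.
Qed.

Lemma sum_incidences : \sum_p incidences p = (#|U| * (#|F| * #|V|))%:R.
Proof.
rewrite exchange_big /=; under eq_bigr => u _ do rewrite sum_lines_at.
by rewrite sumr_const -[LHS]mulr_natl [RHS]natrM.
Qed.

Lemma sum_incidences_sqr :
  \sum_p incidences p ^+ 2 =
  #|U|%:R * #|F|%:R * #|V|%:R + #|U|%:R * (#|U|%:R - 1) * #|V|%:R ^+ 2.
Proof.
under eq_bigr => p _ do rewrite expr2 big_distrlr /=.
rewrite exchange_big /=; under eq_bigr => u _ do rewrite exchange_big /=.
have inner u : u \in U -> \sum_(u' in U) \sum_p on p u * on p u' =
    #|F|%:R * #|V|%:R + (#|U|%:R - 1) * #|V|%:R ^+ 2.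
  (* The diagonal term is a first moment because [on] takes the values 0 and 1. *)
  move=> uU; rewrite (bigD1 u) //=; congr (_ + _).
    rewrite -natrM -(sum_lines_at u); apply: eq_bigr => p _.
    by rewrite /on; case: (_ \in _); rewrite ?mulr0 ?mulr1.
  under eq_bigr => u' /andP[_ u'u] do rewrite sum_lines_at2 1?eq_sym //.
  rewrite sumr_const -[LHS]mulr_natl natrX; congr (_ * _).
  rewrite (cardsD1 u U) uU /= natrD [1%:R + _]addrC addrK; congr (_%:R).
  by apply: eq_card => x; rewrite !inE andbC.
under eq_bigr => u uU do rewrite inner //.
by rewrite sumr_const -[LHS]mulr_natl; ring.
Qed.

(** Deviations from the mean |U| |V| / q are multiplied by q to stay among the integers. *)
Lemma sum_incidences_var :
  \sum_p (#|F|%:R * incidences p - #|U|%:R * #|V|%:R) ^+ 2 =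
  #|F|%:R ^+ 2 * #|U|%:R * #|V|%:R * (#|F|%:R - #|V|%:R).
Proof.
under eq_bigr => p _ do rewrite sqrrB exprMn.
rewrite big_split /= sumrB -mulr_sumr sum_incidences_sqr sumr_const.
rewrite sumrMnl -mulr_suml -mulr_sumr sum_incidences.
rewrite -[_ *+ #|_|]mulr_natl card_prod !natrM; ring.
Qed.

(** Each line in K x L meets no grid point, so it alone contributes (|U| |V|)^2 to the scaled
    variance. The negative term is moved to the left to avoid truncated subtraction. *)
Lemma no_incidence_bound (K L : {set F}) :
    (forall k l u, k \in K -> l \in L -> u \in U -> k * u + l \notin V) ->
  (#|K| * #|L| * (#|U| * #|V|) ^ 2 + #|F| ^ 2 * #|U| * #|V| ^ 2 <=
   #|F| ^ 3 * #|U| * #|V|)%N.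
Proof.
move=> noI; suff: #|K|%:R * #|L|%:R * (#|U|%:R * #|V|%:R) ^+ 2 <=
    #|F|%:R ^+ 2 * #|U|%:R * #|V|%:R * (#|F|%:R - #|V|%:R) :> int by lia.
rewrite -sum_incidences_var (bigID [in setX K L]) /=.
rewrite -[leLHS]addr0 lerD ?sumr_ge0 // => [|p _]; last exact: sqr_ge0.
under eq_bigr => p pKL.
  rewrite /incidences big1 ?mulr0 ?sub0r ?sqrrN; last first.
    move=> u uU; move: pKL; rewrite inE => /andP[pK pL].
    by rewrite /on (negPf (noI _ _ _ pK pL uU)).
  over.
by rewrite sumr_const cardsX -[leRHS]mulr_natl natrM.
Qed.
End Incidences.

(** * Solving a x + b y = c z in a subgroup of index r *)

Lemma index_size_bound (q r m : nat) :
    (2 <= r)%N -> (r ^ 4 <= q)%N -> q = (r * m).+1 ->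
  (q ^ 3 < m ^ 4 + q ^ 2 * m)%N.
Proof.
(* If m < r^3, then r m + r <= r^4 <= q = r m + 1, which forces r <= 1. *)
move=> r2 rq qE; have mr : (r ^ 3 <= m)%N.
  rewrite leqNgt; apply/negP => mr; have : (r * m.+1 <= r * r ^ 3)%N by rewrite leq_mul.
  by rewrite -expnS; lia.
have m8 : (8 <= m)%N by apply: leq_trans mr; rewrite (leq_exp2r 2 r (_ : 0 < 3)%N).
(* Here r^3 m^3 = (q - 1)^3, which falls short of q^3 by less than 3 q^2, and m >= 8. *)
suff : (q ^ 3 < r ^ 3 * m ^ 3 + q ^ 2 * m)%N.
  by move/leq_trans; apply; rewrite leq_add2r (expnS m 3) leq_mul.
rewrite qE; nia.
Qed.

Section Cosets.
Variables (F : finFieldType) (G : {group {unit F}}) (r : nat).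
Hypotheses (r_ge2 : (2 <= r)%N) (qr : (r ^ 4 <= #|F|)%N).
Hypothesis indG : is_index_subgroup r G.
Local Open Scope ring_scope.

Lemma card_index_subgroup : #|F| = (r * #|G|).+1.
Proof.
have := Lagrange (finset.subsetT G); rewrite indG card_finField_unit mulnC => ->.
by rewrite prednK // (cardD1 0).
Qed.

Lemma diagonal_solution (a b c : F) : a != 0 -> b != 0 -> c != 0 ->
  exists x y z : {unit F},
    [/\ x \in G, y \in G, z \in G & a * val x + b * val y = c * val z].
Proof.
move=> a0 b0 c0; apply: contrapT => noS.
pose S t := [set t * val g | g in G]%SET.
have cardS t : t != 0 -> #|S t| = #|G|.
  by move=> t0; apply: card_imset => g h /(mulfI t0)/val_inj.
(* Abscissae range over G, ordinates over cG, slopes over aG, intercepts over bG: an incidence (a x)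
   x' + b y = c z is a solution. *)
have := @no_incidence_bound F (S 1) (S c) (S a) (S b).
rewrite !cardS ?oner_neq0 // => /(_ _)/wrap[] => [k l u|].
  move=> /imsetP[x xG ->] /imsetP[y yG ->] /imsetP[x' x'G ->].
  apply/negP => /imsetP[z zG]; rewrite mul1r -mulrA -FinRing.val_unitM => E.
  by apply: noS; exists (x * x')%g, y, z; rewrite groupM.
have := index_size_bound r_ge2 qr card_index_subgroup.
have : (0 < #|G|)%N by exact: cardG_gt0.
nia.
Qed.

End Cosets.

(* Any two nonzero elements have every nonzero element in their sum; [T] is the
   multiplicative group written additively, [e] plays -1, and [None] is 0. *)
Section SaturatedHyperfield.
Variables (T : zmodType) (e : T).
Local Open Scope ring_scope.
Local Open Scope classical_set_scope.

Definition sat_add : hyperop (option T) := fun A B =>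
  match A, B with
  | Some i, Some j => [set C | C = None -> j = e + i]
  | None, _ => [set B]
  | _, None => [set A]
  end.

Definition sat_mul (A B : option T) : option T :=
  if A is Some i then if B is Some j then Some (i + j) else None else None.

Definition sat_opp : option T -> option T := omap (+%R e).

Hypothesis e2 : e + e = 0.

Lemma sat_addC A B : sat_add A B = sat_add B A.
Proof.
case: A B => [i|] [j|] //=; apply/seteqP.
by split=> C /= h /h ->; rewrite addrA e2 add0r.
Qed.

Lemma sat_add0 A : sat_add None A = [set A]. Proof. by []. Qed.

Lemma sat_addA A B C : \bigcup_(D in sat_add B C) sat_add A D =
                       \bigcup_(D in sat_add A B) sat_add D C.
Proof.
case: A => [i|]; last first.
  rewrite !sat_add0 bigcup_set1; apply/seteqP.
  by split=> [D [D' h ->] //|D h]; exists D.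
case: B => [j|]; last by rewrite !bigcup_set1.
case: C => [k|].
  (* Both sides are everything: nonzero values are reached through any nonzero [D], and 0 through
     the opposite of the remaining summand. *)
  apply/seteqP; split=> -[l|] _; first by exists (Some 0).
  - exists (Some (e + k)) => //= _; by rewrite addrA e2 add0r.
  - by exists (Some 0).
  - by exists (Some (e + i)).
rewrite bigcup_set1; apply/seteqP; split=> D.
  by move=> h; exists D => //; case: D {h}.
by move=> [[l|] h]; [move=> /= -> | rewrite sat_add0 => ->].
Qed.

Lemma sat_rev A B C : sat_add B C A -> sat_add (sat_opp A) C (sat_opp B).
Proof.
case: A B C => [i|] [j|] [k|] //=.
- by move=> [->].
- by move=> [->] _; rewrite addrA e2 add0r.
- by move=> /(_ erefl) ->.
Qed.

Lemma sat_oppK : involutive sat_opp.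
Proof. by case=> //= i; rewrite addrA e2 add0r. Qed.

Lemma sat_hypergroup : is_hypergroup sat_add None sat_opp.
Proof.
split.
- by move=> [i|] [j|]; [exists (Some 0) | exists (Some i) |
    exists (Some j) | exists None].
- exact: sat_addA.
- exact: sat_add0.
- by move=> A; rewrite sat_addC.
- by case.
- by move=> [i|] [j|] //= /(_ erefl) ->.
- by move=> A B C; split=> [|/sat_rev]; rewrite ?sat_oppK //; exact: sat_rev.
Qed.

Lemma sat_mulC A B : sat_mul A B = sat_mul B A.
Proof. by case: A B => [i|] [j|] //=; rewrite addrC. Qed.

Lemma sat_mulA A B C : sat_mul A (sat_mul B C) = sat_mul (sat_mul A B) C.
Proof. by case: A B C => [i|] [j|] [k|] //=; rewrite addrA. Qed.

Lemma sat_mul1 A : sat_mul (Some 0) A = A.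
Proof. by case: A => //= i; rewrite add0r. Qed.

Lemma sat_mulr0 A : sat_mul A None = None. Proof. by case: A. Qed.

Lemma sat_mul_neq0 A B : A <> None -> B <> None -> sat_mul A B <> None.
Proof. by case: A B => [i|] [j|]. Qed.

Lemma sat_mulV A : A <> None -> exists2 B, B <> None & sat_mul A B = Some 0.
Proof. by case: A => // i _; exists (Some (- i)); rewrite //= subrr. Qed.

Lemma sat_mulD A B C :
  sat_mul A @` sat_add B C = sat_add (sat_mul A B) (sat_mul A C).
Proof.
case: A => [i|]; last first.
  (* The image under multiplication by 0 is {0} only because the sum is nonempty. *)
  have [D hD] := hg_nonempty sat_hypergroup B C.
  by apply/seteqP; split=> [_ [_ _ <-] //|_ ->]; exists D.
case: B C => [j|] [k|] /=; rewrite ?image_set1 //.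
apply/seteqP; split=> [_ [[l|] h <-] // _|[l|] h].
- by rewrite (h erefl) addrCA.
- by exists (Some (l - i)) => //=; rewrite addrC subrK.
- by exists None => // _; apply: (addrI i); rewrite h // addrCA.
Qed.

Definition saturated_hyperfield : hyperfield.
refine {|
  hf_sort := option T;
  hf_add := sat_add;
  hf_mul := sat_mul;
  hf_zero := None;
  hf_one := Some 0;
  hf_opp := sat_opp;
  hf_hypergroup := sat_hypergroup;
  hf_addC := sat_addC;
  hf_mul_neq0 := sat_mul_neq0;
  hf_mulA := fun A B C _ _ _ => sat_mulA A B C;
  hf_mulC := fun A B _ _ => sat_mulC A B;
  hf_mul1 := fun A _ => sat_mul1 A;
  hf_mulV := sat_mulV;
  hf_mul0l := fun A => erefl None;
  hf_mul0r := sat_mulr0;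
  hf_mulD := sat_mulD |}.
by [].
Defined.

End SaturatedHyperfield.

(** * Isomorphisms of hyperfields *)

Section Isomorphisms.
Local Open Scope classical_set_scope.

Lemma hyperfield_iso_sym H1 H2 : hyperfield_iso H1 H2 -> hyperfield_iso H2 H1.
Proof. by move=> [f [g [fh gh fK gK]]]; exists g, f. Qed.

Lemma hyperfield_hom_comp (H1 H2 H3 : hyperfield) (f : H1 -> H2) (g : H2 -> H3) :
  is_hyperfield_hom f -> is_hyperfield_hom g -> is_hyperfield_hom (g \o f).
Proof.
move=> [f0 f1 fM fD] [g0 g1 gM gD]; split=> /=.
- by rewrite f0.
- by rewrite f1.
- by move=> a b; rewrite fM gM.
- by move=> a b _ [c h <-]; apply: gD; exists (f c) => //; apply: fD; exists c.
Qed.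

Lemma hyperfield_iso_trans H1 H2 H3 :
  hyperfield_iso H1 H2 -> hyperfield_iso H2 H3 -> hyperfield_iso H1 H3.
Proof.
move=> [f [f' [fh fh' fK fK']]] [g [g' [gh gh' gK gK']]].
exists (g \o f), (f' \o g'); split.
- exact: hyperfield_hom_comp.
- exact: hyperfield_hom_comp.
- exact: can_comp.
- exact: can_comp.
Qed.

(** The condition on sums is an equivalence: a bijective homomorphism may map a sum to a proper
    subset of the target sum, and then its inverse is not a homomorphism. *)
Lemma hyperfield_iso_bij (H1 H2 : hyperfield) (f : H1 -> H2) :
    bijective f -> f (hf_zero H1) = hf_zero H2 -> f (hf_one H1) = hf_one H2 ->
    (forall a b, f (hf_mul a b) = hf_mul (f a) (f b)) ->
    (forall a b c, hf_add a b c <-> hf_add (f a) (f b) (f c)) ->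
  hyperfield_iso H1 H2.
Proof.
move=> [g fK gK] f0 f1 fM fD; exists f, g; split=> //.
  by split=> // a b _ [c h <-]; apply/fD.
split.
- by rewrite -f0 fK.
- by rewrite -f1 fK.
- by move=> a b; apply: (can_inj fK); rewrite fM !gK.
- by move=> a b _ [c h <-]; apply/fD; rewrite !gK.
Qed.

(** In the source, 1 + 1 contains 0. A homomorphism preserves this, and in the target it means [e] =
    0. *)
Lemma saturated_not_iso (T : zmodType) (e : T) (e2 : (e + e = 0)%R)
    (z2 : (0 + 0 = 0 :> T)%R) : e <> 0%R ->
  ~ hyperfield_iso (saturated_hyperfield z2) (saturated_hyperfield e2).
Proof.
move=> e0 [f [_ [[f0 f1 _ fD] _ _ _]]]; apply: e0.
have /= := fD (Some 0%R) (Some 0%R) None.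
rewrite [f (Some _)]f1 /= !addr0 => h; apply/esym/h => //.
by exists None; [ | exact: f0].
Qed.

End Isomorphisms.

(** * Quotients of large fields are saturated *)

Section QuotientOrder.
Variables (F : finFieldType) (G : {group {unit F}}) (r : nat).
Hypothesis indG : is_index_subgroup r G.

Lemma order_coset_generator (y : coset_of G) :
  generator [set: coset_of G] y -> #[y]%g = r.
Proof.
move=> /eqP yE; rewrite orderE -yE -quotientT card_quotient ?indG //.
by apply/fintype.subsetP=> u _; exact: in_norm_unit.
Qed.

End QuotientOrder.

Section QuotientSum.
Variables (F : finFieldType) (G : {group {unit F}}) (r : nat).
Hypotheses (r_ge2 : (2 <= r)%N) (qr : (r ^ 4 <= #|F|)%N).
Hypothesis indG : is_index_subgroup r G.
Local Open Scope ring_scope.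

(** Uniqueness of opposites settles C = 0; a nonzero class is reached by solving a x + b y = c z in
    G, since c z has the class of c. *)
Lemma quot_add_units (e u v : coset_of G) C : quot_class G (-1) = Some e ->
  quot_add (Some u) (Some v) C <-> (C = None -> v = (e * u)%g).
Proof.
move=> eE; have oppu : quot_opp (Some u) = Some (e * u)%g by rewrite /quot_opp eE.
split=> [+ C0|].
  by rewrite {}C0 => /(hg_opp_uniq (quot_hypergroup G)); rewrite oppu => /Some_inj.
case: C => [w _|->//]; last first.
  by rewrite -oppu; exact: hg_oppP (quot_hypergroup G) _.
case: (cosetP u) => a _ ->; case: (cosetP v) => b _ ->; case: (cosetP w) => c _ ->.
have nz (t : {unit F}) : val t != 0 by rewrite -unitfE (valP t).
have [x [y [z [xG yG zG E]]]] := diagonal_solution r_ge2 qr indG (nz a) (nz b) (nz c).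
have cl (t s : {unit F}) : s \in G -> Some (coset G t) = quot_class G (val t * val s).
  by move=> sG; rewrite quot_classM !quot_classU (coset_id sG) quot_mulr1.
exists (val a * val x), (val b * val y).
by rewrite E; split; [rewrite -cl | rewrite -cl | exact: cl].
Qed.

Lemma quotient_iso_saturated (e : 'Z_r) (e2 : e + e = 0) (y : coset_of G) :
    generator [set: coset_of G] y -> quot_class G (-1) = Some (y ^+ e)%g ->
  hyperfield_iso (quotient_hyperfield G) (saturated_hyperfield e2).
Proof.
move=> yG eE.
have oy := order_coset_generator indG yG.
pose f (i : 'Z_r) : coset_of G := (y ^+ i)%g.
have fM i j : f (i + j) = (f i * f j)%g.
  (* The modulus of ['Z_r] is [(Zp_trunc r).+2], which is r because r >= 2. *)
  have yr : (y ^+ (Zp_trunc r).+2)%g = 1%g by rewrite Zp_cast // -oy expg_order.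
  by rewrite /f -expgD -[RHS](expg_mod _ yr).
have finj : injective f.
  move=> i j /eqP; rewrite eq_expg_mod_order oy => /eqP.
  by rewrite -!val_Zp_nat // !natr_Zp => /val_inj.
have [g fK gK] : bijective f.
  by apply: inj_card_bij finj _; rewrite -cardsT (eqP yG) -orderE oy card_ord Zp_cast.
apply: hyperfield_iso_sym.
apply: (@hyperfield_iso_bij (saturated_hyperfield e2) (quotient_hyperfield G) (omap f)).
- by exists (omap g); case=> //= x; rewrite ?fK ?gK.
- by [].
- by rewrite /= /f expg0.
- by move=> [i|] [j|] //=; rewrite fM.
- move=> A B C; case: A => [i|]; last first.
    rewrite /= -/(quot_zero G) quot_add0 /=; split=> [->//|].
    by case: B C => [j|] [k|] //= [/finj ->].
  case: B => [j|]; last first.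
    rewrite /= -/(quot_zero G) quot_addC quot_add0 /=; split=> [->//|].
    by case: C => [k|] //= [/finj ->].
  rewrite [X in _ <-> X]/= quot_add_units //; last exact: eE.
  by rewrite -/(f e) -fM; split=> /= h; case: C h => // h h0;
    [rewrite h | apply: finj; rewrite h].
Qed.

End QuotientSum.

(** * The class of -1 in the quotient *)

Section MinusOne.
Variables (F : finFieldType) (G : {group {unit F}}) (r : nat).
Hypotheses (r_ge2 : (2 <= r)%N) (indG : is_index_subgroup r G).
Local Open Scope ring_scope.

Lemma opp1_neq1 : odd #|F| -> -1 <> 1 :> F.
Proof.
move=> oddF; have [p p_pr pF] := finPcharP F.
have {oddF} oddp : odd p.
  by move: oddF; rewrite (card_pprimeChar pF) oddX; case/orP=> // /eqP n0;
     have := finNzRing_gt1 F; rewrite (card_pprimeChar pF) n0.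
(* With p = 1 + 2 (p - 1)/2 and 2 = 0, the relation p = 0 becomes 1 = 0. *)
move=> N11; have := pcharf0 pF; rewrite -(odd_double_half p) oddp -muln2 natrD natrM.
by rewrite [2%:R](_ : _ = 0) ?mulr0 ?addr0 => [/eqP|];
  rewrite ?oner_eq0 // -[in 2%:R]addn1 natrD -{1}N11 addNr.
Qed.

(** Here [j] is the discrete logarithm of -1 to the base of a generator of F^x, and [y] is the class
    of that generator. *)
Lemma minus_one_power : exists (y : coset_of G) (j : nat),
  [/\ generator [set: coset_of G] y, quot_class G (-1) = Some (y ^+ j)%g,
      (#|F|.-1 %| 2 * j)%N & (#|F|.-1 %| j)%N -> -1 = 1 :> F].
Proof.
have [g gE] := cyclicP (field_unit_group_cyclic [set: {unit F}]).
have og : #[g]%g = #|F|.-1 by rewrite orderE -gE card_finField_unit.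
have nG := in_norm_unit G.
have N1U : (-1 : F) \is a GRing.unit by rewrite unitrN unitr1.
pose w := FinRing.unit F N1U.
have /cycleP[j wE] : w \in <[g]>%g by rewrite -gE inE.
have w2 : (w ^+ 2)%g = 1%g by apply: val_inj; rewrite /= mulrNN mulr1.
exists (coset G g), j; split.
- by rewrite /generator -quotientT gE quotient_cycle.
- by rewrite -morphX // -wE -(quot_classU G w).
- by rewrite -og order_dvdn mulnC expgM -wE w2.
- by rewrite -og order_dvdn -wE => /eqP/(congr1 val).
Qed.

(** Since q - 1 divides 2 j, either divisibility hypothesis gives r | j: by coprimality with 2 if r
    is odd, by cancelling 2 otherwise. So -1 lies in G. *)
Lemma iso_saturated0 (z2 : 0 + 0 = 0 :> 'Z_r) : (r ^ 4 <= #|F|)%N ->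
    (odd r && (r %| #|F|.-1) || (2 * r %| #|F|.-1))%N ->
  hyperfield_iso (quotient_hyperfield G) (saturated_hyperfield z2).
Proof.
move=> qr dvd; have [y [j [yG N1 j2 _]]] := minus_one_power.
apply: quotient_iso_saturated (yG) _ => //; rewrite N1 expg0; congr Some.
apply/eqP; rewrite -order_dvdn (order_coset_generator indG yG).
case/orP: dvd => [/andP[odd_r rq]|rq].
  by rewrite -(@Gauss_dvdr r 2) ?(dvdn_trans rq) // coprimen2.
by rewrite -(@dvdn_pmul2l 2) // (dvdn_trans rq).
Qed.

(** From 2 j = t (q - 1) one gets j = h t (2 k + 1). As -1 differs from 1, t is odd, so j is an odd
    multiple of h = r / 2, congruent to h modulo r. *)
Lemma iso_saturated_half (h k : nat)
    (e2 : h%:R + h%:R = 0 :> 'Z_r) : (r ^ 4 <= #|F|)%N ->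
    r = h.*2 -> #|F|.-1 = (r * k.*2.+1)%N ->
  hyperfield_iso (quotient_hyperfield G) (saturated_hyperfield e2).
Proof.
move=> qr rh qE; have [y [j [yG N1 /dvdnP[t j2] j1]]] := minus_one_power.
apply: quotient_iso_saturated (yG) _ => //; rewrite N1; congr Some.
apply/eqP; rewrite eq_expg_mod_order (order_coset_generator indG yG).
rewrite val_Zp_nat // modn_mod.
have oddF : odd #|F|.
  rewrite -(prednK (_ : 0 < #|F|)%N) ?qE ?rh; last exact: (ltnW (finNzRing_gt1 F)).
  by rewrite /= oddM odd_double.
have jE : j = (h * (t * k.*2.+1))%N by nia.
have odd_t : odd t.
  apply/negP => /negP even_t; apply: (opp1_neq1 oddF); apply: j1.
  rewrite jE qE rh -(odd_double_half t) (negPf even_t) add0n.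
  by apply/dvdnP; exists t./2; lia.
have [s sE] : exists s, (t * k.*2.+1 = s.*2.+1)%N.
  exists (t * k.*2.+1)./2; rewrite -[LHS]odd_double_half oddM odd_t /= odd_double //.
have -> : j = (s * r + h)%N by rewrite jE sE rh; lia.
by rewrite modnMDl.
Qed.

End MinusOne.

(** * Existence of an admissible field, and the two parities of r *)

Lemma exists_char2_field (r N : nat) : odd r ->
  exists F : finFieldType, (N <= #|F|)%N /\ (r %| #|F|.-1)%N.
Proof.
move=> odd_r; have r_gt0 := odd_gt0 odd_r.
(* In 2^(totient r * (N + 1)), Euler's theorem gives the value 1 modulo r, and the factor N + 1
   makes it exceed N. *)
have k_gt0 : (0 < totient r * N.+1)%N by rewrite muln_gt0 totient_gt0 r_gt0.
have [F _ cardF] := pPrimePowerField (isT : prime 2) k_gt0; exists F.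
rewrite cardF; split.
  apply: leq_trans (ltnW (ltn_expl N (isT : 1 < 2))) _; rewrite leq_exp2l //.
  by apply: leq_trans (leqnSn N) _; rewrite leq_pmull ?totient_gt0.
rewrite -subn1 -eqn_mod_dvd ?expn_gt0 // expnM -modnXm.
by rewrite Euler_exp_totient ?coprime2n // modnXm exp1n.
Qed.

Theorem theorem1p1 (r : nat) (r_ge2 : (2 <= r)%N) :
  (odd r ->
    exists H : hyperfield,
      (forall (F : finFieldType) (G : {group {unit F}}),
         (r ^ 4 <= #|F|)%N -> #|F| = 1 %[mod r] -> is_index_subgroup r G ->
         hyperfield_iso (quotient_hyperfield G) H)
      /\
      (forall H' : hyperfield,
         (forall (F : finFieldType) (G : {group {unit F}}),
            (r ^ 4 <= #|F|)%N -> #|F| = 1 %[mod r] -> is_index_subgroup r G ->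
            hyperfield_iso (quotient_hyperfield G) H') ->
         hyperfield_iso H' H))
  /\
  (~~ odd r ->
    exists H H' : hyperfield,
      [/\ ~ hyperfield_iso H H',
          (forall (F : finFieldType) (G : {group {unit F}}),
             (r ^ 4 <= #|F|)%N -> #|F| = 1 %[mod 2 * r] ->
             is_index_subgroup r G ->
             hyperfield_iso (quotient_hyperfield G) H)
        & (forall (F : finFieldType) (G : {group {unit F}}),
             (r ^ 4 <= #|F|)%N -> #|F| = r + 1 %[mod 2 * r] ->
             is_index_subgroup r G ->
             hyperfield_iso (quotient_hyperfield G) H')]).
Proof.
have z2 : (0 + 0 = 0 :> 'Z_r)%R by rewrite addr0.
have dvd_pred (F : finFieldType) d : (#|F| = 1 %[mod d] <-> d %| #|F|.-1)%N.
  have F_gt0 : (0 < #|F|)%N := ltnW (finNzRing_gt1 F).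
  by rewrite -subn1 -eqn_mod_dvd //; split=> /eqP.
split=> [odd_r|even_r].
  have isoH (F : finFieldType) (G : {group {unit F}}) :
      (r ^ 4 <= #|F|)%N -> #|F| = 1 %[mod r] -> is_index_subgroup r G ->
      hyperfield_iso (quotient_hyperfield G) (saturated_hyperfield z2).
    by move=> qr /dvd_pred rq iG; apply: iso_saturated0 => //; rewrite odd_r rq.
  exists (saturated_hyperfield z2); split=> // H' isoH'.
  (* Uniqueness compares H' and H through the quotient of a single admissible field. *)
  have [F [qr rq]] := exists_char2_field (r ^ 4) odd_r.
  have [G [iG _]] := index_subgroup_exists_unique rq.
  move/dvd_pred in rq.
  apply: hyperfield_iso_trans (isoH F G qr rq iG).
  exact: hyperfield_iso_sym (isoH' F G qr rq iG).
set h := r./2; have rh : r = h.*2 by rewrite even_halfK.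
have e2 : (h%:R + h%:R = 0 :> 'Z_r)%R by rewrite -natrD addnn -rh pchar_Zp.
exists (saturated_hyperfield z2), (saturated_hyperfield e2); split.
(* The residue of [h] is nonzero because 0 < h < r. *)
- apply: saturated_not_iso => /(congr1 val).
  by rewrite /= val_Zp_nat // modn_small; lia.
- move=> F G qr /dvd_pred rq iG; apply: iso_saturated0 => //.
  by rewrite rq orbT.
(* With r + 1 <= q, the congruence becomes divisibility of the untruncated difference q - (r + 1) by
   2 r. *)
- move=> F G qr qE iG; have qgt : (r + 1 <= #|F|)%N.
    apply: leq_trans qr; rewrite (leq_trans _ (_ : r ^ 2 <= _)) ?leq_exp2l //.
    by rewrite expnS expn1; nia.
  have /eqP := qE; rewrite eqn_mod_dvd // => /dvdnP[k qk].
  by apply: (@iso_saturated_half F G r r_ge2 iG h k) => //; lia.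
Qed.
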